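(* Let $\mathrm{R}$ be a real closed field, $\mathrm{C}=\mathrm{R}[i]$, let $F/G \in \mathrm{C}(Z)\setminus\{0\}$ and let $\Gamma=[x_0,x_1]\times[y_0,y_1]\subset \mathrm{R}^2$ with $x_0<x_1$, $y_0<y_1$. Then $$\mathrm{W}(F/G \mid \partial\Gamma)=\sum_{z\in\Gamma} c_\Gamma(z)\,\mathrm{val}_z(F/G),$$ where $c_\Gamma(z)=1$ if $z$ is in the interior of $\Gamma$, $c_\Gamma(z)=\tfrac12$ if $z$ lies on an edge of $\Gamma$ but is not a vertex, and $c_\Gamma(z)=\tfrac14$ if $z$ is a vertex of $\Gamma$. In words: $\mathrm{W}(F/G\mid\partial\Gamma)$ equals the number of zeros (with multiplicity) minus the number of poles (with order) of $F/G$ in $\Gamma$, where zeros and poles on the edges count for one half and those at the vertices count for one quarter.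
   Context: Points $(x,y)\in\mathrm{R}^2$ are identified with $x+iy\in\mathrm{C}$. For nonzero $P\in\mathrm{R}[X]$ and $x\in\mathrm{R}$ write uniquely $P=(X-x)^{\mathrm{mult}_x(P)}P_x$ with $P_x(x)\neq0$; for $P,Q\neq0$ set $\mathrm{val}_x(P/Q)=\mathrm{mult}_x(P)-\mathrm{mult}_x(Q)$. For $P,Q\in\mathrm{R}[X]$, $x\in\mathrm{R}$: $\mathrm{Ind}^+_x(P,Q)=\tfrac12\,\mathrm{sign}(P_x(x)Q_x(x))$ and $\mathrm{Ind}^-_x(P,Q)=\tfrac12(-1)^{\mathrm{val}_x(P/Q)}\mathrm{sign}(P_x(x)Q_x(x))$ if $P\ne0$, $Q\neq0$ and $\mathrm{val}_x(P/Q)<0$, and both are $0$ otherwise; $\mathrm{Ind}_x=\mathrm{Ind}^+_x-\mathrm{Ind}^-_x$. For $a<b$, $\mathrm{Ind}_a^b(P,Q)=\mathrm{Ind}_a^+(P,Q)+\sum_{x\in(a,b)}\mathrm{Ind}_x(P,Q)-\mathrm{Ind}_b^-(P,Q)$; $\mathrm{Ind}_a^b=-\mathrm{Ind}_b^a$ if $b<a$, and $\mathrm{Ind}_a^a=0$. For $F\in\mathrm{C}[X,Y]$ let $F_{\rm re},F_{\rm im}\in\mathrm{R}[X,Y]$ with $F=F_{\rm re}+iF_{\rm im}$, and $\overline F=F_{\rm re}-iF_{\rm im}$. Define $\mathrm{w}(F\mid\partial\Gamma)=\tfrac12\big(\mathrm{Ind}_{x_0}^{x_1}(F_{\rm re}(T,y_0),F_{\rm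 im}(T,y_0))+\mathrm{Ind}_{y_0}^{y_1}(F_{\rm re}(x_1,T),F_{\rm im}(x_1,T))+\mathrm{Ind}_{x_1}^{x_0}(F_{\rm re}(T,y_1),F_{\rm im}(T,y_1))+\mathrm{Ind}_{y_1}^{y_0}(F_{\rm re}(x_0,T),F_{\rm im}(x_0,T))\big)$ and $\mathrm{W}(F\mid\partial\Gamma)=\tfrac12\big(\mathrm{w}(F\mid\partial\Gamma)+\mathrm{w}(iF\mid\partial\Gamma)\big)$. $\mathrm{C}[Z]\subset\mathrm{C}[X,Y]$ via $Z=X+iY$. For $F,G\in\mathrm{C}[X,Y]$ with $G\neq0$, $\mathrm{w}(F/G\mid\partial\Gamma):=\mathrm{w}(F\overline G\mid\partial\Gamma)$ and $\mathrm{W}(F/G\mid\partial\Gamma):=\mathrm{W}(F\overline G\mid\partial\Gamma)$ (independent of the representation). For nonzero $F\in\mathrm{C}[Z]$ and $z\in\mathrm{C}$ write $F=(Z-z)^{\mathrm{mult}_z(F)}F_z$ with $F_z(z)\ne0$, and $\mathrm{val}_z(F/G)=\mathrm{mult}_z(F)-\mathrm{mult}_z(G)$ for $F,G\neq0$ (so zeros of $F/G$ have positive valuation equal to multiplicity and poles negative valuation equal to minus the order; only finitely many $z$ have nonzero valuation). *)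

(* Defs.v *)
From HB Require Import structures.
From mathcomp Require Import all_boot all_order all_algebra.
From mathcomp Require Import polyrcf complex.
From mathcomp Require Import classical_sets fsbigop.

Set Implicit Arguments.
Unset Strict Implicit.
Unset Printing Implicit Defensive.

Import Order.TTheory GRing.Theory Num.Theory.
Local Open Scope ring_scope.
Local Open Scope classical_set_scope.

Section Indices.
Variable R : rcfType.
Implicit Types (P Q : {poly R}) (x a b : R).

Definition cofac x P : {poly R} := P %/ ('X - x%:P) ^+ (mup x P).

Definition valR x P Q : int := (mup x P)%:Z - (mup x Q)%:Z.

Definition Ind_plus P Q x : R :=
  if [&& P != 0, Q != 0 & valR x P Q < 0]
  then 2^-1 * Num.sg ((cofac x P).[x] * (cofac x Q).[x]) else 0.

Definition Ind_minus P Q x : R :=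
  if [&& P != 0, Q != 0 & valR x P Q < 0]
  then 2^-1 * (-1) ^ (valR x P Q) * Num.sg ((cofac x P).[x] * (cofac x Q).[x])
  else 0.

Definition Ind_pt P Q x : R := Ind_plus P Q x - Ind_minus P Q x.

Definition Ind_lt a b P Q : R :=
  Ind_plus P Q a + (\sum_(x \in [set x : R | a < x < b]) Ind_pt P Q x)
  - Ind_minus P Q b.

Definition Ind a b P Q : R :=
  if a < b then Ind_lt a b P Q
  else if b < a then - Ind_lt b a P Q else 0.

End Indices.

Section Winding.
Variable R : rcfType.
Local Notation C := R[i].
Implicit Types (F G H : {poly C}).

Definition hline (y : R) : {poly C} := 'X + (Complex 0 y)%:P.
Definition vline (x : R) : {poly C} := (Complex x 0)%:P + (Complex 0 1)%:P * 'X.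

Definition IndC a b (H : {poly C}) : R :=
  Ind a b (map_poly (@complex.Re R) H) (map_poly (@complex.Im R) H).

(* (F * conj G) restricted to the line parametrized by l: for real T,
   F(l(T)) * conj(G(l(T))), i.e. the one-variable polynomials
   (F Gbar)_re(., .) and (F Gbar)_im restricted to the edge. *)
Definition restr F G (l : {poly C}) : {poly C} :=
  (F \Po l) * map_poly (@conjc R) (G \Po l).

Definition wq F G (x0 x1 y0 y1 : R) : R :=
  2^-1 * (IndC x0 x1 (restr F G (hline y0)) + IndC y0 y1 (restr F G (vline x1))
        + IndC x1 x0 (restr F G (hline y1)) + IndC y1 y0 (restr F G (vline x0))).

Definition Wq F G (x0 x1 y0 y1 : R) : R :=
  2^-1 * (wq F G x0 x1 y0 y1 + wq ((Complex 0 1)%:P * F) G x0 x1 y0 y1).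

Definition rect (x0 x1 y0 y1 : R) : set C :=
  [set z : C | (x0 <= complex.Re z <= x1) && (y0 <= complex.Im z <= y1)].

Definition cGamma (x0 x1 y0 y1 : R) (z : C) : R :=
  if (x0 < complex.Re z < x1) && (y0 < complex.Im z < y1) then 1
  else if ((complex.Re z == x0) || (complex.Re z == x1)) && ((complex.Im z == y0) || (complex.Im z == y1))
  then 4^-1
  else 2^-1.

Definition valC (z : C) F G : int := (mup z F)%:Z - (mup z G)%:Z.

End Winding.

(* Main.v *)
(* For F along an edge, Ind(F) + Ind(iF) is the variation of the argument, in
   quarter turns and rounded at the end points.  For a product of two functions
   it is additive up to a term depending only on the leading values at the two
   end points; this term is invariant under multiplication of the leading values
   by i, so it cancels between the two edges meeting at a vertex, even when the
   vertex is a zero or a pole.  Hence W is additive along the boundary of the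
   rectangle.  As R[i] is algebraically closed, it suffices to treat Z - z, where
   the index of a constant c over a polynomial Q on [a, b] is
   sign(c) (sign Q(b) - sign Q(a)) / 2. *)
Require Import Defs.
From HB Require Import structures.
From mathcomp Require Import all_boot all_order all_algebra.
From mathcomp Require Import polyrcf complex.
From mathcomp Require Import classical_sets fsbigop.
From mathcomp Require Import ring lra.
Import Order.TTheory GRing.Theory Num.Theory.
Local Open Scope ring_scope.

Set Implicit Arguments.
Unset Strict Implicit.
Unset Printing Implicit Defensive.

(** * Signs of polynomials on one side of a point *)

Section Germs.
Variable R : rcfType.
Implicit Types (D P Q A B : {poly R}) (x y t : R) (e : bool).

(* The sign of [D] just right ([e = false]) or just left ([e = true]) of [x]. *)
Definition germ e x D : R := (-1) ^+ (e * mup x D) * Num.sg (cofac x D).[x].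

Lemma cofac0 x : cofac x 0 = 0 :> {poly R}.
Proof. by rewrite /cofac div0p. Qed.

Lemma cofacK x D : D = cofac x D * ('X - x%:P) ^+ mup x D.
Proof.
have [->|D0] := eqVneq D 0; first by rewrite cofac0 mul0r.
by rewrite /cofac divpK // -mup_geq.
Qed.

Lemma cofac_neq0 x D : D != 0 -> (cofac x D).[x] != 0.
Proof.
move=> D0; have := D0; rewrite {1}(cofacK x D) mulf_eq0 negb_or => /andP[c0 _].
apply/negP => rc; have := leqnn (mup x D).+1.
suff: ((mup x D).+1 <= mup x D)%N by rewrite ltnn.
by rewrite mup_geq // {2}(cofacK x D) exprS dvdp_mul // dvdp_XsubCl.
Qed.

Lemma cofacM x P Q : cofac x (P * Q) = cofac x P * cofac x Q.
Proof.
have [->|P0] := eqVneq P 0; first by rewrite mul0r cofac0 mul0r.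
have [->|Q0] := eqVneq Q 0; first by rewrite mulr0 cofac0 mulr0.
have X0 n : ('X - x%:P) ^+ n != 0 by rewrite expf_neq0 ?polyXsubC_eq0.
apply: (mulIf (X0 (mup x (P * Q)))); rewrite -cofacK mupM // exprD mulrACA.
by rewrite -!cofacK.
Qed.

Lemma cofac_id x D : D.[x] != 0 -> cofac x D = D.
Proof. by move=> Dx; rewrite /cofac mupNroot // expr0 divp1. Qed.

Lemma germ0 e x : germ e x 0 = 0.
Proof. by rewrite /germ cofac0 horner0 sgr0 mulr0. Qed.

Lemma germM e x P Q : germ e x (P * Q) = germ e x P * germ e x Q.
Proof.
have [->|P0] := eqVneq P 0; first by rewrite mul0r germ0 mul0r.
have [->|Q0] := eqVneq Q 0; first by rewrite mulr0 germ0 mulr0.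
by rewrite /germ cofacM hornerM sgrM mupM // mulnDr exprD mulrACA.
Qed.

Lemma germ_val e x D : D.[x] != 0 -> germ e x D = Num.sg D.[x].
Proof.
by move=> Dx; rewrite /germ cofac_id // mupNroot // muln0 mul1r.
Qed.

Lemma germ_sqr e x D : D != 0 -> germ e x D * germ e x D = 1.
Proof.
move=> /(cofac_neq0 x) Dx.
by rewrite /germ mulrACA -expr2 sqrr_sign mul1r -expr2 sqr_sg Dx.
Qed.

(** By continuity the cofactor stays closer to its value at [x] than that value is to 0, so it keeps
    its sign; the power of ['X - x%:P] supplies the power of -1. *)
Lemma germ_near e x D :
  exists2 d, 0 < d & forall t, 0 < t < d -> Num.sg D.[x + (-1) ^+ e * t] = germ e x D.
Proof.
have [->|D0] := eqVneq D 0.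
  by exists 1 => // t _; rewrite horner0 sgr0 germ0.
have c0 := cofac_neq0 x D0; have nc : 0 < `|(cofac x D).[x]| by rewrite normr_gt0.
have [d d0 dP] := poly_cont x (cofac x D) nc.
exists d => // t /andP[t0 td].
rewrite {1}(cofacK x D) hornerM horner_exp hornerXsubC sgrM addrAC subrr add0r mulrC.
rewrite exprMn sgrM -exprM sgrX sgrN1 [Num.sg (t ^+ _)]gtr0_sg ?exprn_gt0 //.
rewrite mulr1 /germ; congr (_ * _).
have := dP (x + (-1) ^+ e * t); rewrite [x + _]addrC addrK.
rewrite normrM normrX normrN1 expr1n mul1r gtr0_norm // => /(_ td).
rewrite [_ + x]addrC; set u := (cofac x D).[_]; set v := (cofac x D).[x] in c0 *.
case: (ltrgt0P v) c0 => // v0 _ uv.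
  by rewrite !gtr0_sg //; move: uv; rewrite ltr_norml => /andP[]; lra.
by rewrite !ltr0_sg //; move: uv; rewrite ltr_norml => /andP[]; lra.
Qed.

(** The factor [1 + sg u * sg v] vanishes exactly for opposite signs, the one case in which they do
    not determine the sign of [u + v]. *)
Lemma sgrD_mul (u v : R) :
  Num.sg (u + v) * (1 + Num.sg u * Num.sg v) = Num.sg u + Num.sg v.
Proof.
case: (sgrP u) => [->|u0|u0]; first by rewrite add0r mul0r addr0 mulr1 add0r.
- case: (sgrP v) => [->|v0|v0]; first by rewrite addr0 mulr0 addr0 mulr1 gtr0_sg ?addr0.
  + by rewrite gtr0_sg ?addr_gt0 //; ring.
  + by ring.
- case: (sgrP v) => [->|v0|v0]; first by rewrite addr0 mulr0 addr0 mulr1 ltr0_sg ?addr0.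
  + by ring.
  + by rewrite ltr0_sg; [ring|lra].
Qed.

Lemma germD_mul e x A B :
  germ e x (A + B) * (1 + germ e x A * germ e x B) = germ e x A + germ e x B.
Proof.
have [dA dA0 hA] := germ_near e x A; have [dB dB0 hB] := germ_near e x B.
have [d d0 h] := germ_near e x (A + B).
pose m := Num.min d (Num.min dA dB).
have m0 : 0 < m by rewrite !lt_min d0 dA0.
have t0 : 0 < m / 2 by lra.
have tm : m / 2 < m by lra.
have /andP[td] : (m / 2 < d) && (m / 2 < Num.min dA dB).
  by rewrite -lt_min.
rewrite lt_min => /andP[tA tB].
rewrite -(h (m / 2)) -?(hA (m / 2)) -?(hB (m / 2)) ?t0 // hornerD.
exact: sgrD_mul.
Qed.

(** For nonzero [D], both germs are signs of values at distance [m / 2] from the ends, inside the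
    interval, where [D] keeps one sign by the intermediate value theorem. *)
Lemma germ_no_root a b D : a < b -> (D = 0 \/ {in `]a, b[, forall y, ~~ root D y}) ->
  germ false a D = germ true b D.
Proof.
move=> ab [->|nr]; first by rewrite !germ0.
have [da da0 ha] := germ_near false a D; have [db db0 hb] := germ_near true b D.
pose m := Num.min (b - a) (Num.min da db).
have m0 : 0 < m by rewrite !lt_min subr_gt0 ab da0.
have t0 : 0 < m / 2 by lra.
have tm : m / 2 < m by lra.
have /andP[tab] : (m / 2 < b - a) && (m / 2 < Num.min da db).
  by rewrite -lt_min.
rewrite lt_min => /andP[tA tB].
rewrite -(ha (m / 2)) -?(hb (m / 2)) ?t0 // expr0 expr1 mul1r mulN1r.
have inb y : a < y < b -> y \in `]a, b[ by rewrite in_itv.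
by apply: (@polyrN0_itv R `]a, b[ D nr); apply: inb; lra.
Qed.

(** Between consecutive roots of [E] the sign of [D] is constant, so the sum telescopes. A root of
    [E] that is not one of [D] contributes 0, which lets one list of points serve several
    polynomials. *)
Lemma sum_germ_jumps (E D : {poly R}) (a b : R) : a < b -> E != 0 ->
    (forall x, ~~ root E x -> D = 0 \/ ~~ root D x) ->
  \sum_(x <- roots E a b) (germ false x D - germ true x D) =
  germ true b D - germ false a D.
Proof.
move=> ab E0 ED; case: (eqVneq D 0) => [->|D0].
  by rewrite big1 => [|x _]; rewrite !germ0 subrr.
have {}ED x : ~~ root E x -> ~~ root D x.
  by move=> /ED[/eqP|//]; rewrite (negPf D0).
move: {-2}(roots E a b) (erefl (roots E a b)) => s.
elim: s a ab => [|r s IH] a ab.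
  move=> rE; rewrite big_nil (germ_no_root ab) ?subrr //.
  by right => y /(roots_nil E0 (esym rE)) /ED.
move=> /esym/eqP; rewrite roots_cons => /and5P[_ rab /eqP rar _ /eqP rrb].
have /andP[ar rb] : (a < r) && (r < b) by rewrite in_itv /= in rab.
rewrite big_cons (IH r rb (esym rrb)) (germ_no_root ar); first by ring.
by right => y /(roots_nil E0 rar) /ED.
Qed.

(** * One-sided indices at a point *)

Definition Ind_side e P Q x : R :=
  if [&& P != 0, Q != 0 & valR x P Q < 0]
  then 2^-1 * (germ e x P * germ e x Q) else 0.

Lemma Ind_plusE P Q x : Ind_plus P Q x = Ind_side false P Q x.
Proof.
rewrite /Ind_plus /Ind_side; case: ifP => // _.
by rewrite /germ !mul0n !mul1r sgrM.
Qed.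

(** Since [(-1)^(m - n) = (-1)^m * (-1)^n], the sign in [Ind_minus] splits into the signs of the two
    left germs. *)
Lemma Ind_minusE P Q x : Ind_minus P Q x = Ind_side true P Q x.
Proof.
rewrite /Ind_minus /Ind_side; case: ifP => // _.
rewrite /germ !mul1n sgrM -mulrA mulrACA -exprD; congr (_ * (_ * _)).
have N0 : -1 != 0 :> R by rewrite oppr_eq0 oner_eq0.
rewrite /valR expfzDr // exprD; congr (_ * _).
by rewrite -exprnN invr_sign.
Qed.

(** The valuation of the quotient is unchanged, and the germ of [D] enters twice, as a square equal
    to 1. *)
Lemma Ind_side_mul e D P Q x : D != 0 ->
  Ind_side e (D * P) (D * Q) x = Ind_side e P Q x.
Proof.
move=> D0; rewrite /Ind_side !mulf_eq0 !(negPf D0) /=.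
case: (eqVneq P 0) => // P0; case: (eqVneq Q 0) => // Q0 /=.
have -> : valR x (D * P) (D * Q) = valR x P Q.
  by rewrite /valR !mupM // !PoszD; ring.
by case: ifP => // _; rewrite !germM mulrACA germ_sqr // mul1r.
Qed.

Lemma Ind_side_val e P Q x : (P.[x] != 0) || (Q.[x] != 0) ->
  Ind_side e P Q x =
  if Q.[x] == 0 then 2^-1 * (Num.sg P.[x] * germ e x Q) else 0.
Proof.
rewrite /Ind_side; case: (eqVneq Q.[x] 0) => [Qx|Qx _] /=; last first.
  by rewrite /valR (@mupNroot _ x Q) // subr_lt0 ltz_nat !andbF.
rewrite orbF => Px.
have P0 : P != 0 by apply: contraNneq Px => ->; rewrite horner0.
rewrite P0 /valR (@mupNroot _ x P) // subr_lt0 ltz_nat.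
(* The zero polynomial also passes the test [Q.[x] == 0]; its germ 0 makes the two sides agree. *)
case: (eqVneq Q 0) => [->|Q0] /=; first by rewrite germ0 !mulr0.
by rewrite -XsubC_dvd // dvdp_XsubCl /root Qx eqxx (@germ_val e x P).
Qed.

(** The value at the point of the half sign whose germ enters the product formula; [p * q' + q * p']
    is the imaginary part of the product of [p + i q] and [p' + i q']. As it does not depend on the
    side, it cancels at inner points. *)
Definition Ind_defect (p q p' q' : R) : R := 2^-1 * Num.sg (q * q' * (p * q' + q * p')).

(* The poles of the cotangent [P / Q] count half turns, and cot(s + t) wraps
   around exactly when cot s + cot t changes sign, i.e. when the sign of
   [Q * Q' * (P * Q' + Q * P')] changes. *)
Lemma Ind_sideM_val e (P Q P' Q' : {poly R}) x :
    (P.[x] != 0) || (Q.[x] != 0) -> (P'.[x] != 0) || (Q'.[x] != 0) ->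
  Ind_side e (P * P' - Q * Q') (P * Q' + Q * P') x =
  Ind_side e P Q x + Ind_side e P' Q' x
  - 2^-1 * germ e x (Q * Q' * (P * Q' + Q * P'))
  + Ind_defect P.[x] Q.[x] P'.[x] Q'.[x].
Proof.
move=> PQ PQ'.
have PQ2 : ((P * P' - Q * Q').[x] != 0) || ((P * Q' + Q * P').[x] != 0).
  rewrite !(hornerD, hornerN, hornerM) -negb_and; apply/negP => /andP[/eqP h1 /eqP h2].
  (* The norm is multiplicative, so the two parts of the product have no common zero at [x]
     either. *)
  have : (P.[x] ^+ 2 + Q.[x] ^+ 2) * (P'.[x] ^+ 2 + Q'.[x] ^+ 2) = 0.
    transitivity ((P.[x] * P'.[x] - Q.[x] * Q'.[x]) ^+ 2
                  + (P.[x] * Q'.[x] + Q.[x] * P'.[x]) ^+ 2); first by ring.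
    by rewrite h1 h2; ring.
  move/eqP; rewrite mulf_eq0 !paddr_eq0 ?sqr_ge0 // !sqrf_eq0.
  by move: PQ PQ'; rewrite -!negb_and => /negPf-> /negPf->.
rewrite !Ind_side_val // /Ind_defect !germM.
have [Q0|Qn] := eqVneq Q.[x] 0; have [Q0'|Qn'] := eqVneq Q'.[x] 0.
- move: PQ PQ'; rewrite Q0 Q0' eqxx !orbF => Pn Pn'.
  rewrite !(hornerD, hornerN, hornerM) Q0 Q0' !(mulr0, mul0r, addr0, subr0) eqxx.
  rewrite sgr0 mulr0 addr0 sgrM.
  (* Both denominators vanish, hence also that of the product. Its germ [r] need not be determined
     by the other germs, but the relation [germD_mul], multiplied by [p * p'], is exactly what is
     needed. *)
  have := germD_mul e x (P * Q') (Q * P').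
  rewrite !germM (@germ_val e x P) // (@germ_val e x P') //.
  have := sqr_sg P.[x]; have := sqr_sg P'.[x]; rewrite Pn Pn' /=.
  set p := Num.sg P.[x]; set p' := Num.sg P'.[x].
  set q := germ e x Q; set q' := germ e x Q'; set r := germ e x _ => h' h h2.
  have -> : p * p' * r = p * p' * (p * q' + q * p') - (p ^+ 2) * (p' ^+ 2) * q * q' * r.
    by rewrite -h2; ring.
  have -> : p * p' * (p * q' + q * p') = p ^+ 2 * p' * q' + p' ^+ 2 * p * q by ring.
  by rewrite h h'; ring.
- move: PQ; rewrite Q0 eqxx orbF => Pn.
  rewrite !(hornerD, hornerN, hornerM) Q0 !(mulr0, mul0r, addr0, subr0) sgr0.
  rewrite mulf_eq0 (negPf Pn) (negPf Qn') /=.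
  have -> : germ e x (P * Q' + Q * P') = Num.sg (P.[x] * Q'.[x]).
    by rewrite germ_val !(hornerD, hornerN, hornerM) Q0 mul0r addr0 ?mulf_neq0.
  rewrite sgrM (@germ_val e x Q') //.
  have := sqr_sg Q'.[x]; rewrite Qn' mulr1n => h.
  transitivity (2^-1 * (Num.sg P.[x] * germ e x Q) * (1 - Num.sg Q'.[x] ^+ 2)); last by ring.
  by rewrite h; ring.
- move: PQ'; rewrite Q0' eqxx orbF => Pn.
  rewrite !(hornerD, hornerN, hornerM) Q0' !(mulr0, mul0r, add0r, addr0, subr0) sgr0.
  rewrite mulf_eq0 (negPf Pn) (negPf Qn) /=.
  have -> : germ e x (P * Q' + Q * P') = Num.sg (Q.[x] * P'.[x]).
    by rewrite germ_val !(hornerD, hornerN, hornerM) Q0' mulr0 add0r ?mulf_neq0.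
  rewrite sgrM (@germ_val e x Q) //.
  have := sqr_sg Q.[x]; rewrite Qn mulr1n => h.
  transitivity (2^-1 * (Num.sg P'.[x] * germ e x Q') * (1 - Num.sg Q.[x] ^+ 2)); last by ring.
  by rewrite h; ring.
rewrite (@germ_val e x Q) // (@germ_val e x Q') //.
have [Q2|Qn2] := eqVneq (P * Q' + Q * P').[x] 0; last first.
  by rewrite germ_val // !(hornerD, hornerN, hornerM) !sgrM; ring.
rewrite add0r sub0r.
have h : P.[x] * Q'.[x] + Q.[x] * P'.[x] = 0 by move: Q2; rewrite !(hornerD, hornerN, hornerM).
rewrite h mulr0 sgr0 mulr0 addr0.
(* Here only the denominator of the product vanishes: [P * Q' = - (Q * P')] at [x], so the numerator
   times [Q * Q'] is minus a sum of squares, one of them nonzero. *)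
suff -> : Num.sg (P * P' - Q * Q').[x] = - (Num.sg Q.[x] * Num.sg Q'.[x]) by ring.
rewrite !(hornerD, hornerN, hornerM) -sgrM -sgrN; set u := _ - _; set v := Q.[x] * Q'.[x] in u *.
have vn : v != 0 by rewrite mulf_neq0.
have uv : u * v = - ((P'.[x] * Q.[x]) ^+ 2 + v ^+ 2).
  have -> : u * v = (P.[x] * Q'.[x]) * (P'.[x] * Q.[x]) - v ^+ 2 by rewrite /u /v; ring.
  have -> : P.[x] * Q'.[x] = - (Q.[x] * P'.[x]) by apply/eqP; rewrite -addr_eq0 h.
  by ring.
have v2 : 0 < v ^+ 2 by rewrite exprn_even_gt0.
have {}uv : u * v < 0 by rewrite uv oppr_lt0 ltr_wpDl // sqr_ge0.
case: (ltrgt0P v) vn => // v0 _.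
  by rewrite [RHS]ltr0_sg ?oppr_lt0 // ltr0_sg //; rewrite pmulr_llt0 in uv.
by rewrite [RHS]gtr0_sg ?oppr_gt0 // gtr0_sg //; rewrite nmulr_llt0 in uv.
Qed.

End Germs.

(** * Product formula for the Cauchy index *)

Section FactoringAt.
Variable K : fieldType.
Implicit Types (F G : {poly K}) (v : K).

(* The value at [v] of the [F_v] in the paper's [F = (Z - v)^mult F_v]. *)
Definition lead_at v F : K := (F %/ ('X - v%:P) ^+ mup v F).[v].

Lemma root_factor v F : F != 0 ->
  exists m F1, F1.[v] != 0 /\ F = F1 * ('X - v%:P) ^+ m.
Proof.
by move=> F0; have [m [F1]] := multiplicity_XsubC F v; rewrite F0 => F1v ->; exists m, F1.
Qed.

Lemma lead_at_factor v m F : F.[v] != 0 ->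
  lead_at v (F * ('X - v%:P) ^+ m) = F.[v].
Proof.
move=> Fv; rewrite /lead_at mupMr // mup_XsubCX eqxx mulpK //.
by rewrite expf_neq0 // polyXsubC_eq0.
Qed.

Lemma lead_at_val v F : F.[v] != 0 -> lead_at v F = F.[v].
Proof. by move=> /(lead_at_factor 0); rewrite expr0 mulr1. Qed.

Lemma lead_atM v F G : F != 0 -> G != 0 ->
  lead_at v (F * G) = lead_at v F * lead_at v G.
Proof.
move=> /(root_factor v)[m [F1 [h1 ->]]] /(root_factor v)[n [G1 [h2 ->]]].
by rewrite mulrACA -exprD !lead_at_factor ?hornerM // mulf_neq0.
Qed.

Lemma mupN v F : mup v (- F) = mup v F.
Proof.
by rewrite -mulN1r mupMr // -polyC1 -polyCN rootC oppr_eq0 oner_eq0.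
Qed.

Lemma lead_at_neq0 v F : F != 0 -> lead_at v F != 0.
Proof.
by move=> /(root_factor v)[m [F1 [h ->]]]; rewrite lead_at_factor.
Qed.

End FactoringAt.

(** * Real and imaginary parts of complex polynomials *)

Section ComplexPairs.
Local Open Scope complex_scope.
Variable R : rcfType.
Local Notation C := R[i].
Local Notation Re := (@complex.Re R).
Local Notation Im := (@complex.Im R).
Local Notation Rp := (map_poly (@complex.Re R)).
Local Notation Ip := (map_poly (@complex.Im R)).
Implicit Types (H K : {poly C}) (x a b : R) (e : bool).

Lemma ReM (z w : C) : Re (z * w) = Re z * Re w - Im z * Im w.
Proof. by case: z w => ? ? []. Qed.

Lemma ImM (z w : C) : Im (z * w) = Re z * Im w + Im z * Re w.
Proof. by case: z w => ? ? []. Qed.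

Lemma RpM H K : Rp (H * K) = Rp H * Rp K - Ip H * Ip K.
Proof.
apply/polyP => i; rewrite coefB !coefM coef_map coefM raddf_sum -sumrB.
by apply: eq_bigr => j _; rewrite !coef_map; exact: ReM.
Qed.

Lemma IpM H K : Ip (H * K) = Rp H * Ip K + Ip H * Rp K.
Proof.
apply/polyP => i; rewrite coefD !coefM coef_map coefM raddf_sum -big_split.
by apply: eq_bigr => j _; rewrite !coef_map; exact: ImM.
Qed.

Lemma RpIpE H :
  H = map_poly (real_complex R) (Rp H) + 'i%:P * map_poly (real_complex R) (Ip H).
Proof.
apply/polyP => i; rewrite coefD coefCM !coef_map /=.
exact: complexE.
Qed.

Lemma horner_RpIp H x : H.[x%:C] = (Rp H).[x]%:C + 'i * (Ip H).[x]%:C.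
Proof. by rewrite {1}(RpIpE H) hornerD hornerM hornerC !horner_map. Qed.

Lemma horner_Rp H x : (Rp H).[x] = Re H.[x%:C].
Proof.
rewrite horner_RpIp -[RHS]/((Rp H).[x] + (0 * (Ip H).[x] - 1 * 0)).
by rewrite mul0r mulr0 subr0 addr0.
Qed.

Lemma horner_Ip H x : (Ip H).[x] = Im H.[x%:C].
Proof.
rewrite horner_RpIp -[RHS]/(0 + (0 * 0 + 1 * (Ip H).[x])).
by rewrite mul0r mul1r !add0r.
Qed.

Lemma Rp_real (D : {poly R}) : Rp (map_poly (real_complex R) D) = D.
Proof. by apply/polyP => i; rewrite !coef_map. Qed.

Lemma Ip_real (D : {poly R}) : Ip (map_poly (real_complex R) D) = 0.
Proof. by apply/polyP => i; rewrite !coef_map coef0. Qed.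

Lemma map_XsubCX x m :
  ('X - (x%:C)%:P) ^+ m = map_poly (real_complex R) (('X - x%:P) ^+ m).
Proof. by rewrite rmorphXn rmorphB /= map_polyX map_polyC. Qed.

Lemma RpMr H (D : {poly R}) : Rp (H * map_poly (real_complex R) D) = D * Rp H.
Proof. by rewrite RpM Rp_real Ip_real mulr0 subr0 mulrC. Qed.

Lemma IpMr H (D : {poly R}) : Ip (H * map_poly (real_complex R) D) = D * Ip H.
Proof. by rewrite IpM Rp_real Ip_real mulr0 add0r mulrC. Qed.

Definition mul_defect (f g : C) : R := 2^-1 * Num.sg (Im f * Im g * Im (f * g)).

(** The powers of ['X - x] are real, so they divide both parts and drop out of each index; the
    remaining parts have no common zero at [x]. In the germ term these powers form a square. *)
Lemma Ind_sideM e H K x : H != 0 -> K != 0 ->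
  Ind_side e (Rp (H * K)) (Ip (H * K)) x =
  Ind_side e (Rp H) (Ip H) x + Ind_side e (Rp K) (Ip K) x
  - 2^-1 * germ e x (Ip H * Ip K * Ip (H * K))
  + mul_defect (lead_at x%:C H) (lead_at x%:C K).
Proof.
move=> /(@root_factor C x%:C)[m [H1 [h1 ->]]] /(@root_factor C x%:C)[n [K1 [h2 ->]]].
rewrite mulrACA -exprD !lead_at_factor // !map_XsubCX !RpMr !IpMr.
have X0 k : ('X - x%:P) ^+ k != 0 by rewrite expf_neq0 ?polyXsubC_eq0.
have nz L : L.[x%:C] != 0 -> ((Rp L).[x] != 0) || ((Ip L).[x] != 0).
  by rewrite horner_Rp horner_Ip -negb_and eq_complex.
rewrite !Ind_side_mul // RpM IpM (Ind_sideM_val _ (nz _ h1) (nz _ h2)).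
congr (_ - 2^-1 * _ + _).
  have -> : ('X - x%:P) ^+ m * Ip H1 * (('X - x%:P) ^+ n * Ip K1) *
     (('X - x%:P) ^+ (m + n) * (Rp H1 * Ip K1 + Ip H1 * Rp K1)) =
     (('X - x%:P) ^+ (m + n) * ('X - x%:P) ^+ (m + n)) *
       (Ip H1 * Ip K1 * (Rp H1 * Ip K1 + Ip H1 * Rp K1)).
    by rewrite exprD; ring.
  by rewrite (germM _ _ _ (_ * _)) (germM _ _ _ (_ ^+ _)) germ_sqr // mul1r.
by rewrite /Ind_defect /mul_defect !horner_Rp !horner_Ip ImM.
Qed.

(** Only roots of a nonzero [Q] carry an index, and points without index may be added to the sum, so
    one [E] can serve several pairs. *)
Lemma Ind_lt_roots a b (P Q E : {poly R}) : E != 0 ->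
    (forall x, ~~ root E x -> Q = 0 \/ ~~ root Q x) ->
  Ind_lt a b P Q = Ind_side false P Q a +
    (\sum_(x <- roots E a b) (Ind_side false P Q x - Ind_side true P Q x))
    - Ind_side true P Q b.
Proof.
move=> E0 EQ; rewrite /Ind_lt Ind_plusE Ind_minusE; congr (_ + _ - _).
under [RHS]eq_bigr do rewrite -Ind_plusE -Ind_minusE -/(Ind_pt _ _ _).
have inroots x : x \in roots E a b = (a < x < b) && root E x.
  by rewrite -(roots_on_roots a b E0 x) in_itv.
rewrite (fsbigE (roots E a b)) ?uniq_roots //.
- rewrite [LHS]big_seq_cond [RHS]big_seq; apply: eq_bigl => x.
  by apply: andb_idr; rewrite inroots => /andP[xab _]; exact: mem_set.
- by move=> x /=; rewrite inroots => /andP[].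
move=> x /= xab; rewrite inroots xab /= => /EQ Qx.
rewrite /Ind_pt Ind_plusE Ind_minusE.
case: Qx => [->|Qx]; first by rewrite /Ind_side eqxx andbF subrr.
have side0 e : Ind_side e P Q x = 0.
  by rewrite /Ind_side /valR (@mupNroot _ x Q) // subr_lt0 ltz_nat !andbF.
by rewrite !side0 subrr.
Qed.

(** Sum [Ind_sideM] over all points. At inner points the defects of the two sides cancel; the germ
    terms telescope and cancel against those at [a] and [b], so only the defects at the end points
    remain. *)
Lemma IndC_mul a b H K : H != 0 -> K != 0 ->
  IndC a b (H * K) = IndC a b H + IndC a b K
   + mul_defect (lead_at a%:C H) (lead_at a%:C K)
   - mul_defect (lead_at b%:C H) (lead_at b%:C K).
Proof.
move=> H0 K0; wlog ab : a b / a < b.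
  move=> W; have [ab|ba|->] := ltrgtP a b; first exact: W.
    have := W b a ba; rewrite /IndC /Ind ba (lt_gtF ba) => ->; ring.
  by rewrite /IndC /Ind ltxx !add0r subrr.
rewrite /IndC /Ind ab.
(* A vanishing imaginary part is replaced by 1, so that the product [E] is nonzero and has finitely
   many roots. *)
pose nz (Q : {poly R}) := if Q == 0 then 1 else Q.
have nz0 Q : nz Q != 0 by rewrite /nz; case: (eqVneq Q 0) => // _; exact: oner_neq0.
have nzr Q x : ~~ root (nz Q) x -> Q = 0 \/ ~~ root Q x.
  by rewrite /nz; case: (eqVneq Q 0) => [->|_]; [left|right].
pose E := nz (Ip H) * nz (Ip K) * nz (Ip (H * K)).
have E0 : E != 0 by rewrite !mulf_neq0.
have h1 x : ~~ root E x -> Ip H = 0 \/ ~~ root (Ip H) x.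
  by rewrite !rootM !negb_or => /andP[/andP[/nzr]].
have h2 x : ~~ root E x -> Ip K = 0 \/ ~~ root (Ip K) x.
  by rewrite !rootM !negb_or => /andP[/andP[_ /nzr]].
have h3 x : ~~ root E x -> Ip (H * K) = 0 \/ ~~ root (Ip (H * K)) x.
  by rewrite !rootM !negb_or => /andP[_ /nzr].
rewrite !(Ind_lt_roots a b _ E0) //.
pose D := Ip H * Ip K * Ip (H * K).
have hD x : ~~ root E x -> D = 0 \/ ~~ root D x.
  move=> Ex; rewrite /D.
  case: (h1 x Ex) => [->|r1]; first by left; rewrite !mul0r.
  case: (h2 x Ex) => [->|r2]; first by left; rewrite mulr0 mul0r.
  case: (h3 x Ex) => [->|r3]; first by left; rewrite mulr0.
  by right; rewrite !rootM !negb_or r1 r2.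
have jumps := sum_germ_jumps ab E0 hD.
under eq_bigr => x _.
  rewrite !Ind_sideM // -/D (_ : _ - _ =
    (Ind_side false (Rp H) (Ip H) x - Ind_side true (Rp H) (Ip H) x)
    + (Ind_side false (Rp K) (Ip K) x - Ind_side true (Rp K) (Ip K) x)
    + (- 2^-1) * (germ false x D - germ true x D)); last by ring.
  over.
rewrite !big_split /= -mulr_sumr jumps !Ind_sideM // -/D; ring.
Qed.

(** * Constant numerators and denominators, changes of sign *)

Lemma Ind_den_const a b (P : {poly R}) (c : R) : Ind a b P c%:P = 0.
Proof.
wlog ab : a b / a < b.
  move=> W; have [ab|ba|->] := ltrgtP a b; first exact: W.
    by have := W b a ba; rewrite /Ind ba (lt_gtF ba) => ->; rewrite oppr0.
  by rewrite /Ind ltxx.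
have noroot x : c%:P = 0 \/ ~~ root c%:P x.
  by rewrite rootC; case: (eqVneq c 0) => [->|c0]; [left|right].
have side0 e x : Ind_side e P c%:P x = 0.
  case: (noroot x) => [->|nr]; first by rewrite /Ind_side eqxx andbF.
  by rewrite /Ind_side /valR (mupNroot nr) subr_lt0 ltz_nat !andbF.
rewrite /Ind ab (Ind_lt_roots a b _ (oner_neq0 _)) => [|x _]; last exact: noroot.
by rewrite !side0 subr0 add0r big1 // => x _; rewrite !side0 subrr.
Qed.

(** The difference of the germ and the sign of [Q.[x]] is the germ at a root and 0 elsewhere. It
    thus describes the one-sided index at every point, and the jumps telescope. *)
Lemma Ind_num_const a b (Q : {poly R}) (c : R) :
  Ind a b c%:P Q = 2^-1 * Num.sg c * (Num.sg Q.[b] - Num.sg Q.[a]).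
Proof.
wlog ab : a b / a < b.
  move=> W; have [ab|ba|->] := ltrgtP a b; first exact: W.
    by have := W b a ba; rewrite /Ind ba (lt_gtF ba) => ->; ring.
  by rewrite /Ind ltxx subrr mulr0.
have [->|Q0] := eqVneq Q 0.
  by rewrite -(polyC0 R) Ind_den_const polyC0 !horner0 subrr mulr0.
have [->|c0] := eqVneq c 0.
  rewrite sgr0 mulr0 mul0r /Ind ab (Ind_lt_roots a b _ Q0) => [|x]; last by right.
  have side0 e x : Ind_side e 0%:P Q x = 0 by rewrite /Ind_side eqxx.
  by rewrite !side0 subr0 add0r big1 // => x _; rewrite !side0 subrr.
have sideE e x : Ind_side e c%:P Q x =
    2^-1 * Num.sg c * (germ e x Q - Num.sg Q.[x]).
  rewrite Ind_side_val ?hornerC ?c0 //.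
  have [->|Qx] := eqVneq Q.[x] 0; first by rewrite sgr0; ring.
  by rewrite (germ_val _ Qx) subrr mulr0.
rewrite /Ind ab (Ind_lt_roots a b _ Q0) => [|x]; last by right.
under eq_bigr => x _.
  rewrite !sideE -mulrBr (_ : _ - _ - _ = germ false x Q - germ true x Q); last by ring.
  over.
rewrite -mulr_sumr sum_germ_jumps // => [|x]; last by right.
by rewrite !sideE; ring.
Qed.

Lemma germN e x (P : {poly R}) : germ e x (- P) = - germ e x P.
Proof.
rewrite -mulN1r germM -(polyC1 R) -polyCN germ_val hornerC ?sgrN1 ?mulN1r //.
by rewrite oppr_eq0 oner_eq0.
Qed.

Lemma Ind_sideNl e (P Q : {poly R}) x : Ind_side e (- P) Q x = - Ind_side e P Q x.
Proof.
rewrite /Ind_side /valR oppr_eq0 mupN germN.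
by case: ifP => _; rewrite ?oppr0 // mulNr mulrN.
Qed.

Lemma Ind_sideNr e (P Q : {poly R}) x : Ind_side e P (- Q) x = - Ind_side e P Q x.
Proof.
rewrite /Ind_side /valR oppr_eq0 mupN germN.
by case: ifP => _; rewrite ?oppr0 // !mulrN.
Qed.

Lemma Ind_opp a b (P Q P' Q' : {poly R}) :
    (forall e x, Ind_side e P' Q' x = - Ind_side e P Q x) ->
    (forall x, root Q' x = root Q x) -> (Q' == 0) = (Q == 0) ->
  Ind a b P' Q' = - Ind a b P Q.
Proof.
move=> sideN rootQ Q00; wlog ab : a b / a < b.
  move=> W; have [ab|ba|->] := ltrgtP a b; first exact: W.
    by have := W b a ba; rewrite /Ind ba (lt_gtF ba) => ->.
  by rewrite /Ind ltxx oppr0.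
pose E := if Q == 0 then 1 else Q.
have E0 : E != 0 by rewrite /E; case: (eqVneq Q 0) => // _; exact: oner_neq0.
have EQ x : ~~ root E x -> Q = 0 \/ ~~ root Q x.
  by rewrite /E; case: (eqVneq Q 0) => [->|_]; [left|right].
have EQ' x : ~~ root E x -> Q' = 0 \/ ~~ root Q' x.
  rewrite /E rootQ; case: (eqVneq Q 0) Q00 => [_ /eqP Q0|_ _]; last by right.
  by left.
rewrite /Ind ab !(Ind_lt_roots a b _ E0) // !sideN.
under eq_bigr => x _ do rewrite !sideN -opprD.
by rewrite sumrN; ring.
Qed.

Lemma IndNl a b (P Q : {poly R}) : Ind a b (- P) Q = - Ind a b P Q.
Proof. by apply: Ind_opp => // e x; exact: Ind_sideNl. Qed.

Lemma IndNr a b (P Q : {poly R}) : Ind a b P (- Q) = - Ind a b P Q.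
Proof.
apply: Ind_opp => [e x|x|]; first exact: Ind_sideNr.
  by rewrite rootN.
by rewrite oppr_eq0.
Qed.

(** * Variation of the argument *)

Definition IndJ a b H : R := IndC a b H + IndC a b ('i%:P * H).

Lemma RpMi H : Rp ('i%:P * H) = - Ip H.
Proof.
apply/polyP => i; rewrite coefN !coef_map coefCM /=.
by case: (H`_i) => u v /=; rewrite mul0r mul1r sub0r.
Qed.

Lemma IpMi H : Ip ('i%:P * H) = Rp H.
Proof.
apply/polyP => i; rewrite !coef_map coefCM /=.
by case: (H`_i) => u v /=; rewrite mul0r mul1r add0r.
Qed.

Lemma IndJE a b H : IndJ a b H = Ind a b (Rp H) (Ip H) - Ind a b (Ip H) (Rp H).
Proof. by rewrite /IndJ /IndC RpMi IpMi IndNl. Qed.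

(** Negating the imaginary part changes the sign of both indices in [IndJE]. *)
Lemma IndJ_conj a b H : IndJ a b (map_poly (@conjc R) H) = - IndJ a b H.
Proof.
have RpJ : Rp (map_poly (@conjc R) H) = Rp H.
  by apply/polyP => i; rewrite !coef_map /=; case: (H`_i).
have IpJ : Ip (map_poly (@conjc R) H) = - Ip H.
  by apply/polyP => i; rewrite coefN !coef_map /=; case: (H`_i).
by rewrite !IndJE RpJ IpJ IndNl IndNr; ring.
Qed.

Lemma IndJ_const a b (c : C) : IndJ a b c%:P = 0.
Proof. by rewrite IndJE !map_polyC /= !Ind_den_const subrr. Qed.

(* The failure of additivity of [IndJ] on one edge. Since [IndJ] counts quarter
   turns, it does not change when [f] or [g] is rotated by a quarter turn. *)
Definition corner (f g : C) : R :=
  mul_defect f g + mul_defect ('i * f) g - mul_defect 'i g.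

Lemma iC_neq0 : 'i != 0 :> C.
Proof. by rewrite eq_complex /= oner_eq0 andbF. Qed.

(** The product formula for [H * K] and for [('i * H) * K] yields [IndC a b K] twice; one copy
    becomes [IndC] of ['i * K] by the formula for that product, whence the term [mul_defect 'i g] in
    [corner]. *)
Lemma IndJM a b H K : H != 0 -> K != 0 ->
  IndJ a b (H * K) = IndJ a b H + IndJ a b K
   + corner (lead_at a%:C H) (lead_at a%:C K)
   - corner (lead_at b%:C H) (lead_at b%:C K).
Proof.
move=> H0 K0; have i0 : 'i%:P != 0 :> {poly C} by rewrite polyC_eq0 iC_neq0.
have leadi x : lead_at x%:C ('i%:P : {poly C}) = 'i.
  by rewrite lead_at_val hornerC // iC_neq0.
have Indi : IndC a b 'i%:P = 0 by rewrite /IndC !map_polyC Ind_den_const.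
have iH0 : 'i%:P * H != 0 by rewrite mulf_neq0.
rewrite /IndJ mulrA (IndC_mul a b H0 K0) (IndC_mul a b iH0 K0).
rewrite (IndC_mul a b i0 K0) Indi !(lead_atM _ i0 H0) !leadi /corner; ring.
Qed.

(** As [mul_defect] is even in [f], a quarter turn of [f] only swaps the first two terms. *)
Lemma cornerMil (f g : C) : corner ('i * f) g = corner f g.
Proof.
rewrite /corner /mul_defect !(ImM, ReM) /= !mul0r !mul1r !sub0r !add0r.
by rewrite [X in X - _]addrC; congr (_ * Num.sg _ + _ * Num.sg _ - _); ring.
Qed.

(** A finite check over the signs of [a], [b], [c], [d]; [sgrD_mul] controls the sign of
    [a * c - b * d] where these leave it open. *)
Lemma corner_sgr (a b c d : R) : (a != 0) || (b != 0) -> (c != 0) || (d != 0) ->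
  Num.sg (a * d * (a * c - b * d)) - Num.sg (d * c) =
  Num.sg (c * b * (a * c - b * d)) - Num.sg (b * a).
Proof.
have := sgrD_mul (a * c) (- (b * d)); rewrite !sgrM sgrN !sgrM.
set s := Num.sg (_ - _).
case: (sgrP a) => _; case: (sgrP b) => _;
  case: (sgrP c) => _; case: (sgrP d) => _ //= h _ _; lra.
Qed.

(** Symmetry carries the invariance under quarter turns over to the second argument. The first terms
    are symmetric at once; [corner_sgr] handles the others. *)
Lemma cornerC (f g : C) : f != 0 -> g != 0 -> corner f g = corner g f.
Proof.
case: f g => a b [c d]; rewrite !eq_complex /= !negb_and => ab cd.
rewrite /corner /mul_defect !(ImM, ReM) /= !mul0r !mul1r !sub0r !add0r.
have -> : d * b * (c * b + d * a) = b * d * (a * d + b * c) by ring.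
have -> : - b * d + a * c = a * c - b * d by ring.
have -> : - d * b + c * a = a * c - b * d by ring.
have := corner_sgr ab cd; lra.
Qed.

(* [vector] exports another [vline]. *)
Local Notation vline := (@Defs.vline R).

Lemma expi_neq0 m : 'i ^+ m != 0 :> C.
Proof. by rewrite expf_neq0 // iC_neq0. Qed.

Lemma corner_expi m n (f g : C) : f != 0 -> g != 0 ->
  corner ('i ^+ m * f) ('i ^+ n * g) = corner f g.
Proof.
have expil k (u v : C) : corner ('i ^+ k * u) v = corner u v.
  elim: k => [|k IH]; first by rewrite expr0 mul1r.
  by rewrite exprS -mulrA cornerMil.
move=> f0 g0; rewrite expil cornerC ?mulf_neq0 ?expi_neq0 // expil.
by rewrite cornerC.
Qed.

(** * Leading values along horizontal and vertical lines *)

Lemma lead_at_conj H x : H != 0 ->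
  lead_at x%:C (map_poly (@conjc R) H) = conjc (lead_at x%:C H).
Proof.
move=> /(@root_factor _ x%:C)[m [H1 [h ->]]].
have Hx : (map_poly (@conjc R) H1).[x%:C] = conjc H1.[x%:C].
  by rewrite -horner_map /= oppr0.
rewrite lead_at_factor // rmorphM rmorphXn /= map_polyXsubC /= oppr0.
by rewrite lead_at_factor Hx // conjc_eq0.
Qed.

Lemma conji_exp m : conjc ('i ^+ m : C) = 'i ^+ (3 * m).
Proof.
rewrite rmorphXn exprM; congr (_ ^+ _).
by apply/eqP; rewrite eq_complex !exprS expr0 /=; apply/andP; split; apply/eqP; ring.
Qed.

Lemma horner_hline x y : (hline y).[x%:C] = x +i* y.
Proof. by rewrite !hornerE /=; congr Complex; rewrite ?addr0 ?add0r. Qed.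

Lemma horner_vline x y : (vline x).[y%:C] = x +i* y.
Proof.
rewrite !hornerE -[LHS]/((x + (0 * y - 1 * 0)) +i* (0 + (0 * 0 + 1 * y))).
by congr Complex; ring.
Qed.

Lemma hlineB x y : hline y - (x +i* y)%:P = 'X - (x%:C)%:P.
Proof.
rewrite /hline -addrA -polyCB; congr ('X + _); rewrite -polyCN; congr (_%:P).
by apply/eqP; rewrite eq_complex /= sub0r subrr oppr0 !eqxx.
Qed.

Lemma vlineB x y : vline x - (x +i* y)%:P = 'i%:P * ('X - (y%:C)%:P).
Proof.
rewrite /vline mulrBr addrAC -polyCB addrC; congr (_ + _).
rewrite -polyCM -polyCN; congr (_%:P).
by apply/eqP; rewrite eq_complex /= subrr sub0r !mul0r !mul1r subr0 oppr0 add0r !eqxx.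
Qed.

Lemma lead_at_hline (F : {poly C}) x y : F != 0 ->
  lead_at x%:C (F \Po hline y) = lead_at (x +i* y) F.
Proof.
move=> /(@root_factor _ (x +i* y))[m [F1 [h ->]]].
rewrite comp_polyM rmorphXn /= comp_polyB comp_polyX comp_polyC hlineB.
by rewrite !lead_at_factor // horner_comp horner_hline.
Qed.

(** On a vertical line [Z - z] becomes ['i] times a monic real linear factor, so each unit of
    multiplicity contributes one factor ['i]. *)
Lemma lead_at_vline (F : {poly C}) x y : F != 0 ->
  exists m, lead_at y%:C (F \Po vline x) = 'i ^+ m * lead_at (x +i* y) F.
Proof.
move=> /(@root_factor _ (x +i* y))[m [F1 [h ->]]]; exists m.
rewrite comp_polyM rmorphXn /= comp_polyB comp_polyX comp_polyC vlineB.
have Fv : ((F1 \Po vline x) * ('i ^+ m)%:P).[y%:C] = 'i ^+ m * F1.[x +i* y].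
  by rewrite hornerM hornerC horner_comp horner_vline mulrC.
rewrite exprMn -polyC_exp mulrA !lead_at_factor ?Fv //.
by rewrite mulf_neq0 ?expi_neq0.
Qed.

Lemma hline_neq0 (F : {poly C}) y : F != 0 -> F \Po hline y != 0.
Proof.
move=> F0; have := lead_at_neq0 (0 +i* y) F0; rewrite -lead_at_hline //.
by apply: contraNneq => ->; rewrite /lead_at div0p horner0.
Qed.

Lemma vline_neq0 (F : {poly C}) x : F != 0 -> F \Po vline x != 0.
Proof.
move=> F0; have [m lead] := lead_at_vline x 0 F0.
have : 'i ^+ m * lead_at (x +i* 0) F != 0 by rewrite mulf_neq0 ?expi_neq0 ?lead_at_neq0.
by rewrite -lead; apply: contraNneq => ->; rewrite /lead_at div0p horner0.
Qed.

Lemma restr_hline_neq0 (F G : {poly C}) y : F != 0 -> G != 0 -> restr F G (hline y) != 0.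
Proof. by move=> F0 G0; rewrite mulf_neq0 ?map_poly_eq0 ?hline_neq0. Qed.

Lemma restr_vline_neq0 (F G : {poly C}) x : F != 0 -> G != 0 -> restr F G (vline x) != 0.
Proof. by move=> F0 G0; rewrite mulf_neq0 ?map_poly_eq0 ?vline_neq0. Qed.

Lemma lead_at_restr (F G : {poly C}) x y : F != 0 -> G != 0 ->
  exists m, lead_at y%:C (restr F G (vline x)) =
            'i ^+ m * lead_at x%:C (restr F G (hline y)).
Proof.
move=> F0 G0; have [m leadF] := lead_at_vline x y F0.
(* [G] enters conjugated, and the conjugate of ['i ^+ n] is ['i ^+ (3 * n)]. *)
have [n leadG] := lead_at_vline x y G0; exists (m + 3 * n)%N.
rewrite !lead_atM ?map_poly_eq0 ?hline_neq0 ?vline_neq0 //.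
rewrite !lead_at_conj ?hline_neq0 ?vline_neq0 // leadF leadG !lead_at_hline //.
by rewrite rmorphM /= conji_exp exprD mulrACA.
Qed.

(* At a vertex that is a zero or a pole, the leading values along the two edges
   differ by a power of [i], which [corner] does not see. *)
Lemma corner_restr (F G F' G' : {poly C}) x y :
    F != 0 -> G != 0 -> F' != 0 -> G' != 0 ->
  corner (lead_at y%:C (restr F G (vline x))) (lead_at y%:C (restr F' G' (vline x))) =
  corner (lead_at x%:C (restr F G (hline y))) (lead_at x%:C (restr F' G' (hline y))).
Proof.
move=> F0 G0 F'0 G'0.
have [m ->] := lead_at_restr x y F0 G0; have [n ->] := lead_at_restr x y F'0 G'0.
by rewrite corner_expi // lead_at_neq0 // restr_hline_neq0.
Qed.

Lemma restrM (F G F' G' l : {poly C}) :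
  restr (F * F') (G * G') l = restr F G l * restr F' G' l.
Proof. by rewrite /restr !comp_polyM rmorphM mulrACA. Qed.

Lemma restrC_conj (G l : {poly C}) :
  restr 1 G l = map_poly (@conjc R) (restr G 1 l).
Proof. by rewrite /restr -!polyC1 !comp_polyC !polyC1 rmorph1 mulr1 mul1r. Qed.

(** * The boundary of the rectangle *)

Variables x0 x1 y0 y1 : R.

Definition IndJ_rect (F G : {poly C}) : R :=
  IndJ x0 x1 (restr F G (hline y0)) + IndJ y0 y1 (restr F G (vline x1))
  + IndJ x1 x0 (restr F G (hline y1)) + IndJ y1 y0 (restr F G (vline x0)).

Lemma Wq_IndJ (F G : {poly C}) : Wq F G x0 x1 y0 y1 = 4^-1 * IndJ_rect F G.
Proof.
have restr_i l : restr ('i%:P * F) G l = 'i%:P * restr F G l.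
  by rewrite /restr comp_polyM comp_polyC mulrA.
rewrite /Wq /wq !restr_i /IndJ_rect /IndJ.
by do !move: (IndC _ _ _) => ?; field.
Qed.

(** Each vertex ends one edge and starts the next, so by [corner_restr] its two corner terms
    cancel. *)
Lemma IndJ_rectM (F G F' G' : {poly C}) :
    F != 0 -> G != 0 -> F' != 0 -> G' != 0 ->
  IndJ_rect (F * F') (G * G') = IndJ_rect F G + IndJ_rect F' G'.
Proof.
move=> F0 G0 F'0 G'0; rewrite /IndJ_rect !restrM.
have hM a b y := IndJM a b (restr_hline_neq0 y F0 G0) (restr_hline_neq0 y F'0 G'0).
have vM a b x := IndJM a b (restr_vline_neq0 x F0 G0) (restr_vline_neq0 x F'0 G'0).
rewrite !hM !vM !corner_restr //.
by do !move: (IndJ _ _ _) => ?; do !move: (corner _ _) => ?; ring.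
Qed.

(** On each edge [1 / G] is represented by the conjugate of [G]. *)
Lemma IndJ_rect_inv (G : {poly C}) : IndJ_rect 1 G = - IndJ_rect G 1.
Proof.
rewrite /IndJ_rect !restrC_conj !IndJ_conj.
by do !move: (IndJ _ _ _) => ?; ring.
Qed.

Lemma IndJ_rect_const (c d : C) : IndJ_rect c%:P d%:P = 0.
Proof.
have restr_const l : restr c%:P d%:P l = (c * conjc d)%:P.
  by rewrite /restr !comp_polyC map_polyC polyCM.
by rewrite /IndJ_rect !restr_const !IndJ_const !addr0.
Qed.

(** * Linear factors *)

Definition weight (lo hi t : R) : R := 2^-1 * (Num.sg (hi - t) + Num.sg (t - lo)).

Lemma Rp_Cartesian (P Q : {poly R}) :
  Rp (map_poly (real_complex R) P + 'i%:P * map_poly (real_complex R) Q) = P.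
Proof. by rewrite raddfD /= RpMi Rp_real Ip_real subr0. Qed.

Lemma Ip_Cartesian (P Q : {poly R}) :
  Ip (map_poly (real_complex R) P + 'i%:P * map_poly (real_complex R) Q) = Q.
Proof. by rewrite raddfD /= IpMi Rp_real Ip_real add0r. Qed.

Lemma restr_linear (z : C) (l : {poly C}) : restr ('X - z%:P) 1 l = l - z%:P.
Proof.
rewrite /restr comp_polyB comp_polyX -polyC1 !comp_polyC.
by rewrite polyC1 rmorph1 mulr1.
Qed.

Lemma imaginaryE (y : R) : 0 +i* y = 'i * y%:C.
Proof. by apply/eqP; rewrite eq_complex /= !mul0r mulr0 mul1r subr0 add0r !eqxx. Qed.

(** The imaginary part of [Z - z] is constant on a horizontal line, so in [IndJE] the first index
    vanishes and the second has a constant numerator. On vertical lines the roles are exchanged. *)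
Lemma IndJ_hline a b y (z : C) :
  IndJ a b (restr ('X - z%:P) 1 (hline y)) =
  2^-1 * Num.sg (Im z - y) * (Num.sg (b - Re z) - Num.sg (a - Re z)).
Proof.
have -> : restr ('X - z%:P) 1 (hline y) = map_poly (real_complex R) ('X - (Re z)%:P)
          + 'i%:P * map_poly (real_complex R) (y - Im z)%:P.
  rewrite restr_linear map_polyXsubC map_polyC /hline {1}[z]complexE imaginaryE /=.
  by rewrite rmorphB !polyCD !polyCM polyCN; ring.
rewrite IndJE Rp_Cartesian Ip_Cartesian Ind_den_const Ind_num_const !hornerXsubC.
by rewrite -[Im z - y]opprB sgrN; ring.
Qed.

Lemma IndJ_vline a b x (z : C) :
  IndJ a b (restr ('X - z%:P) 1 (vline x)) =
  2^-1 * Num.sg (x - Re z) * (Num.sg (b - Im z) - Num.sg (a - Im z)).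
Proof.
have -> : restr ('X - z%:P) 1 (vline x) = map_poly (real_complex R) (x - Re z)%:P
          + 'i%:P * map_poly (real_complex R) ('X - (Im z)%:P).
  rewrite restr_linear map_polyXsubC map_polyC /Defs.vline {1}[z]complexE /=.
  by rewrite rmorphB !polyCD !polyCM polyCN; ring.
by rewrite IndJE Rp_Cartesian Ip_Cartesian Ind_den_const Ind_num_const !hornerXsubC subr0.
Qed.

(** The two horizontal edges together contribute twice the product of the weights, and so do the two
    vertical ones. *)
Lemma IndJ_rect_linear (z : C) :
  IndJ_rect ('X - z%:P) 1 = 4 * (weight x0 x1 (Re z) * weight y0 y1 (Im z)).
Proof.
have sgB u v : Num.sg (u - v) = - Num.sg (v - u) :> R by rewrite -sgrN opprB.
rewrite /IndJ_rect !IndJ_hline !IndJ_vline /weight.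
rewrite (sgB x0) (sgB y0) (sgB (Im z) y1).
by field.
Qed.

Lemma IndJ_rect_factors (F G : {poly C}) (r s : seq C) :
    F != 0 -> G != 0 ->
    F = lead_coef F *: \prod_(z <- r) ('X - z%:P) ->
    G = lead_coef G *: \prod_(z <- s) ('X - z%:P) ->
  IndJ_rect F G = \sum_(z <- r) IndJ_rect ('X - z%:P) 1
                - \sum_(z <- s) IndJ_rect ('X - z%:P) 1.
Proof.
have prodE t : IndJ_rect (\prod_(z <- t) ('X - z%:P)) 1 =
               \sum_(z <- t) IndJ_rect ('X - z%:P) 1.
  elim: t => [|z t IH]; first by rewrite !big_nil -(polyC1 C) IndJ_rect_const.
  rewrite !big_cons -IH -[X in IndJ_rect _ X = _]mulr1 IndJ_rectM ?oner_neq0 //.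
    by rewrite polyXsubC_eq0.
  by rewrite monic_neq0 // monic_prod_XsubC.
have facE (H : {poly C}) t : H != 0 -> H = lead_coef H *: \prod_(z <- t) ('X - z%:P) ->
    IndJ_rect H 1 = \sum_(z <- t) IndJ_rect ('X - z%:P) 1.
  move=> H0 ->; rewrite -mul_polyC -[X in IndJ_rect _ X = _]mulr1 IndJ_rectM ?oner_neq0 //.
  - by rewrite -{2}(polyC1 C) IndJ_rect_const add0r.
  - by rewrite polyC_eq0 lead_coef_eq0.
  - by rewrite monic_neq0 // monic_prod_XsubC.
move=> F0 G0 Fr Gs; rewrite -(facE _ _ F0 Fr) -(facE _ _ G0 Gs) -IndJ_rect_inv.
have one0 : 1 != 0 :> {poly C} := oner_neq0 _.
by rewrite -(IndJ_rectM F0 one0 one0 G0) mulr1 mul1r.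
Qed.

(** * Weights of points and counting of multiplicities *)

Definition in_rect (z : C) := (x0 <= Re z <= x1) && (y0 <= Im z <= y1).

(** Each value of the weight comes with the outcomes of the tests in [in_rect] and [cGamma]; the
    product of two weights is then found in nine cases, with one quarter at the vertices. *)
Lemma weightP (lo hi t : R) : lo < hi ->
  [\/ [/\ weight lo hi t = 1, lo <= t <= hi, lo < t < hi & ((t == lo) || (t == hi)) = false],
      [/\ weight lo hi t = 2^-1, lo <= t <= hi, (lo < t < hi) = false & (t == lo) || (t == hi)]
    | weight lo hi t = 0 /\ (lo <= t <= hi) = false].
Proof.
have sg1 u v : u < v -> Num.sg (v - u) = 1 :> R by move=> uv; rewrite gtr0_sg ?subr_gt0.
have sgN1 u v : u < v -> Num.sg (u - v) = -1 :> R by move=> uv; rewrite ltr0_sg ?subr_lt0.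
move=> lohi; rewrite /weight.
have [tlo|lot|->] := ltrgtP t lo.
- by apply: Or33; split=> //; rewrite (sg1 t) ?(lt_trans tlo) // sgN1 //; ring.
- have [thi|hit|->] := ltrgtP t hi.
  + by apply: Or31; split=> //; rewrite !sg1 //; field.
  + by apply: Or33; split=> //; rewrite (sgN1 hi) // sg1 //; ring.
  + by apply: Or32; split=> //; rewrite subrr sgr0 sg1 //; ring.
- by apply: Or32; split; rewrite ?ltW //; rewrite subrr sgr0 sg1 //; ring.
Qed.

Lemma weight_rect (z : C) : x0 < x1 -> y0 < y1 ->
  weight x0 x1 (Re z) * weight y0 y1 (Im z) =
  if in_rect z then cGamma x0 x1 y0 y1 z else 0.
Proof.
move=> xx yy; rewrite /in_rect /cGamma.
case: (weightP (Re z) xx) => [[-> -> -> ->]|[-> -> -> ->]|[-> ->]];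
  case: (weightP (Im z) yy) => [[-> -> -> ->]|[-> -> -> ->]|[-> ->]] //=;
  rewrite ?mulr0 ?mul0r ?mulr1 ?mul1r //; by field.
Qed.

(** Repetitions in [r] become multiplicities. Allowing a larger [u] puts zeros and poles on one
    common list. *)
Lemma sum_count (r u : seq C) (w : C -> R) : uniq u -> {subset r <= u} ->
  \sum_(z <- r) w z = \sum_(z <- u) w z * (count_mem z r)%:R.
Proof.
move=> uu; elim: r => [|z r IH] ru.
  by rewrite big_nil big1 // => z _; rewrite mulr0.
rewrite big_cons IH => [|t tr]; last by rewrite ru // inE tr orbT.
under [RHS]eq_bigr => t _ do rewrite /= natrD mulrDr.
rewrite big_split /=; congr (_ + _).
rewrite (bigD1_seq z) ?ru ?mem_head //= eqxx mulr1 big1 ?addr0 // => t tz.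
by rewrite eq_sym (negPf tz) mulr0.
Qed.

End ComplexPairs.

Local Open Scope classical_set_scope.

Theorem theorem1p12 (R : rcfType) (F G : {poly R[i]}) (x0 x1 y0 y1 : R) :
  F != 0 -> G != 0 -> x0 < x1 -> y0 < y1 ->
  Wq F G x0 x1 y0 y1 =
  \sum_(z \in rect x0 x1 y0 y1) cGamma x0 x1 y0 y1 z * (valC z F G)%:~R.
Proof.
move=> F0 G0 x01 y01.
have [r Fr] := closed_field_poly_normal F; have [s Gs] := closed_field_poly_normal G.
have mupE (H : {poly R[i]}) t z : H != 0 ->
    H = lead_coef H *: \prod_(z <- t) ('X - z%:P) -> mup z H = count_mem z t.
  move=> H0 ->; rewrite -mul_polyC mupMr ?mu_prod_XsubC //.
  by rewrite rootC lead_coef_eq0.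
pose w z := weight x0 x1 (complex.Re z) * weight y0 y1 (complex.Im z).
pose u := undup (r ++ s).
have uu : uniq u by exact: undup_uniq.
have ru : {subset r <= u} by move=> z zr; rewrite mem_undup mem_cat zr.
have su : {subset s <= u} by move=> z zs; rewrite mem_undup mem_cat zs orbT.
have -> : Wq F G x0 x1 y0 y1 = \sum_(z <- u) w z * (valC z F G)%:~R.
  rewrite Wq_IndJ (IndJ_rect_factors _ _ _ _ F0 G0 Fr Gs).
  under eq_bigr do rewrite IndJ_rect_linear.
  under [X in _ - X]eq_bigr do rewrite IndJ_rect_linear.
  rewrite -!mulr_sumr -/w (sum_count w uu ru) (sum_count w uu su) -mulrBr mulKf ?pnatr_eq0 //.
  rewrite -sumrB; apply: eq_bigr => z _.
  by rewrite /valC (mupE _ _ z F0 Fr) (mupE _ _ z G0 Gs) rmorphB /= mulrBr.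
(* Points of [u] outside the rectangle have weight 0, and points of the rectangle outside [u] have
   valuation 0. *)
rewrite (fsbigE [seq z <- u | in_rect x0 x1 y0 y1 z]) ?filter_uniq //.
- rewrite big_filter_cond [RHS]big_mkcond; apply: eq_bigr => z _.
  rewrite /w weight_rect //; case: ifP => zrect /=; last by rewrite mul0r.
  by rewrite mem_set.
- by move=> z /=; rewrite mem_filter => /andP[].
move=> z zrect; rewrite mem_filter [in_rect _ _ _ _ _]zrect /= => zu.
rewrite /valC (mupE _ _ z F0 Fr) (mupE _ _ z G0 Gs).
have [zr zs] : z \notin r /\ z \notin s.
  by apply/andP; rewrite -negb_or -mem_cat -mem_undup.
by rewrite !(count_memPn _) // subrr mulr0.
Qed.
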